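(* Let $D$ be a positive integer that is not a perfect square, and let $k$ be a nonzero integer for which the norm class $\mathbb{Z}_k(\sqrt{D})$ is nonempty. Suppose $\mathbb{Z}_k(\sqrt{D})$ is partitioned into $m$ orbits under the multiplicative action of $\mathbb{Z}_1(\sqrt{D})$, and for each $i\in\{1,\dots,m\}$ let $\alpha_i$ be an element of the $i$-th orbit. Let $\tau_{i,1},\tau_{i,2},\tau_{i,3},\tau_{i,4}$ ($1\le i\le m$) be the canonical orbit sequences of $\alpha_i$, and let $\sigma_1,\dots,\sigma_{4m}$ be a listing of these $4m$ sequences in any order. Write the interleavement $\mathcal{I}(\sigma_1,\dots,\sigma_{4m})$ as $(X_r+Y_r\sqrt{D}:r\in\mathbb{N})$ with $X_r,Y_r\in\mathbb{Z}$. Then both $(X_r:r\in\mathbb{N})$ and $(Y_r:r\in\mathbb{N})$ are strong Benford sequences.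
   Context: For a positive non-square integer $D$, $\mathbb{Z}(\sqrt{D})=\{a+b\sqrt{D}:a,b\in\mathbb{Z}\}$, the norm of $a+b\sqrt{D}$ is $a^2-Db^2$, and $\mathbb{Z}_k(\sqrt{D})$ is the set of elements of norm $k$. $\mathbb{Z}_1(\sqrt{D})$ is a group under multiplication (the unit group), acting on $\mathbb{Z}_k(\sqrt{D})$ by multiplication; the orbit of $\alpha$ is $\{\gamma\alpha:\gamma\in\mathbb{Z}_1(\sqrt{D})\}$. The fundamental element $\beta_1=x_1+y_1\sqrt{D}$ of $\mathbb{Z}_1(\sqrt{D})$ is the element with $x_1,y_1>0$ for which $(x_1,y_1)$ is lexicographically minimal; let $\beta_2=x_1-y_1\sqrt{D}$. The canonical orbit sequences of an element $\alpha$ are $\tau_1(\alpha)=(\alpha\beta_1^n:n\in\mathbb{N})$, $\tau_2(\alpha)=(\alpha\beta_2^n:n\in\mathbb{N})$, $\tau_3(\alpha)=(-\alpha\beta_1^n:n\in\mathbb{N})$, $\tau_4(\alpha)=(-\alpha\beta_2^n:n\in\mathbb{N})$, where $\mathbb{N}=\{1,2,\dots\}$. The interleavement $z=\mathcal{I}(\sigma_1,\dots,\sigma_K)$ of sequences $\sigma_j=(s_{j,n}:n\in\mathbb{N})$ is defined by $z_{K(n-1)+i}=s_{i,n}$ for all $n\in\mathbb{N}$, $1\le i\le K$. For a nonzero real $x$ and $j\ge1$, $D_j(x)$ is the $j$-th most significant decimal digit of $|x|$. A real sequence $(s_n)$ is a strong Benford sequence if every $s_n\neq0$ and for every positive integer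 $p$, every $d_1\in\{1,\dots,9\}$ and $d_2,\dots,d_p\in\{0,\dots,9\}$, $$\lim_{N\to\infty}\frac{|\{1\le n\le N: D_j(s_n)=d_j,\ 1\le j\le p\}|}{N}=\log_{10}\Big(1+\frac{1}{\sum_{j=1}^p 10^{p-j}d_j}\Big).$$
   Formalization: A term X_r or Y_r can be zero (D=2, k=1, α_1=β_1 gives Y_r=0 at β_1β_2=1), so it is proved, for X and Y separately, that the sequence is strong Benford if it has no zero term, and always so after deleting finitely many initial terms. *)

(* Defs.v *)
From mathcomp Require Import all_boot all_order all_algebra.
From mathcomp Require Import all_classical all_reals all_analysis.

Set Implicit Arguments.
Unset Strict Implicit.
Unset Printing Implicit Defensive.

Import Order.TTheory GRing.Theory Num.Theory.
Import numFieldNormedType.Exports.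
Local Open Scope classical_set_scope.
Local Open Scope ring_scope.

(* Z(sqrt D) is taken inside the reals. The index set {1, 2, ...} is encoded
   by nat throughout: s n stands for the term usually written s_(n+1). *)

Definition zsqrt (R : realType) (D : nat) (a b : int) : R :=
  a%:~R + b%:~R * Num.sqrt D%:R.

Definition int_norm (D : nat) (a b : int) : int := a ^+ 2 - D%:Z * b ^+ 2.

Definition norm_class (R : realType) (D : nat) (k : int) : set R :=
  [set z | exists a b : int, z = zsqrt R D a b /\ int_norm D a b = k].
Arguments norm_class : clear implicits.

Definition unit_orbit (R : realType) (D : nat) (alpha : R) : set R :=
  [set gamma * alpha | gamma in norm_class R D 1].

Definition orbits (R : realType) (D : nat) (k : int) : set (set R) :=
  [set unit_orbit D alpha | alpha in norm_class R D k].
Arguments orbits : clear implicits.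

Definition fundamental (D : nat) (x1 y1 : int) : Prop :=
  [/\ 0 < x1, 0 < y1, int_norm D x1 y1 = 1 &
      forall x y : int, 0 < x -> 0 < y -> int_norm D x y = 1 ->
        x1 < x \/ x1 = x /\ y1 <= y].

Definition canonical_orbit_seq (R : realType) (D : nat) (x1 y1 : int)
    (alpha : R) (c : 'I_4) (n : nat) : R :=
  let beta1 := zsqrt R D x1 y1 in
  let beta2 := zsqrt R D x1 (- y1) in
  match val c with
  | 0%N => alpha * beta1 ^+ n.+1
  | 1%N => alpha * beta2 ^+ n.+1
  | 2%N => - alpha * beta1 ^+ n.+1
  | _ => - alpha * beta2 ^+ n.+1
  end.

Definition is_interleavement (T : Type) (K : nat) (s : 'I_K -> nat -> T)
    (z : nat -> T) : Prop :=
  forall (n : nat) (i : 'I_K), z (K * n + i)%N = s i n.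

Definition log10 (R : realType) (x : R) : R := ln x / ln 10.

(* For x != 0 and j >= 1: with e = floor (log10 |x|), the leading digit of |x|
   has place value 10 ^ e, hence the j-th one is the unit digit of
   floor (|x| * 10 ^ (j - 1 - e)). *)
Definition sig_digit (R : realType) (j : nat) (x : R) : int :=
  (Num.floor (`|x| * 10 ^ (j%:Z - 1 - Num.floor (log10 `|x|))) %% 10)%Z.

Definition digits_count (R : realType) (s : nat -> R) (p : nat) (d : nat -> nat)
    (N : nat) : nat :=
  #|[pred n : 'I_N | [forall j : 'I_p, sig_digit j.+1 (s n) == (d j.+1)%:Z]]|.

Definition strong_benford (R : realType) (s : nat -> R) : Prop :=
  (forall n, s n <> 0) /\
  forall (p : nat) (d : nat -> nat),
    (0 < p)%N -> (1 <= d 1 <= 9)%N ->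
    (forall j, (2 <= j <= p)%N -> (d j <= 9)%N) ->
    (digits_count s p d N)%:R / N%:R @[N --> \oo] -->
      log10 (1 + 1 / (\sum_(1 <= j < p.+1) 10 ^ (p - j) * d j)%N%:R : R).

(* Main.v *)
Require Import Defs.
From mathcomp Require Import all_boot all_order all_algebra.
From mathcomp Require Import all_classical all_reals all_analysis.
From mathcomp Require Import ring lra zify.

Import Order.TTheory GRing.Theory Num.Theory.
Import numFieldNormedType.Exports.
Local Open Scope classical_set_scope.
Local Open Scope ring_scope.

(** Write beta for the fundamental unit, so that its conjugate is beta^-1.
    Along each residue class of the interleavement both coordinates have the
    form A beta^n + B beta^-n with A != 0, hence log10 |s_n| is
    n log10 beta + c + o(1), and log10 beta is irrational because
    10^p + 10^-p is never an integer for p > 0. A block of leading digits says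
    that log10 |s_n| mod 1 lies in a certain interval, so everything follows
    from equidistribution of irrational rotations.

    Only upper bounds #{n < N : y_n in I} <= (|I| + e) N + C are needed, since
    the complement of an interval of the circle is an interval. For the
    rotation, pick q with q theta = p + d, d small. The sawtooth
    H(f) = min(f, L) - L f with L = |I| + d takes values in [0, 1] and satisfies
    d (1_I(y) - L) <= H({y + d}) - H({y}); summed over the orbit, the
    right-hand side telescopes with shift q and is at most q. *)

(** * Counting functions of sets of indices *)

Definition prefix_count (P : pred nat) (N : nat) : nat := \sum_(n < N) P n.

(** Amounts to a bound on the limsup of the counts divided by [N]. The constant [C] absorbs shifts,
    finitely many exceptions and incomplete periods. *)
Definition upper_density_le (R : realType) (P : pred nat) (l : R) : Prop :=
  forall e : R, 0 < e ->
    exists C : R, forall N, (prefix_count P N)%:R <= (l + e) * N%:R + C.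

Lemma prefix_countS (P : pred nat) N :
  prefix_count P N.+1 = (prefix_count P N + P N)%N.
Proof. by rewrite /prefix_count big_ord_recr. Qed.

Lemma prefix_countD (P : pred nat) M N :
  prefix_count P (M + N) =
  (prefix_count P M + prefix_count (fun n => P (M + n)%N) N)%N.
Proof. by rewrite /prefix_count big_split_ord. Qed.

Lemma leq_prefix_count (P : pred nat) M N :
  (M <= N)%N -> (prefix_count P M <= prefix_count P N)%N.
Proof. by move=> /subnKC <-; rewrite prefix_countD leq_addr. Qed.

Lemma prefix_count_le (P : pred nat) N : (prefix_count P N <= N)%N.
Proof.
elim: N => [|N IH]; first by rewrite /prefix_count big_ord0.
by rewrite prefix_countS; case: (P N); lia.
Qed.

Lemma prefix_countC (P : pred nat) N :
  (prefix_count P N + prefix_count (predC P) N = N)%N.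
Proof.
elim: N => [|N IH]; first by rewrite /prefix_count !big_ord0.
by rewrite !prefix_countS /=; case: (P N) => /=; lia.
Qed.

Lemma prefix_count_eventually_sub (P Q : pred nat) n0 :
  (forall n, (n0 <= n)%N -> P n -> Q n) ->
  forall N, (prefix_count P N <= prefix_count Q N + n0)%N.
Proof.
move=> PQ N; have [Nn0|n0N] := leqP N n0.
  by apply: leq_trans (prefix_count_le _ _) _; lia.
rewrite -(subnKC (ltnW n0N)) !prefix_countD addnAC.
apply: leq_add; first by apply: leq_trans (prefix_count_le _ _) _; lia.
apply: leq_sum => i _; have := PQ (n0 + i)%N (leq_addr _ _).
by case: (P _) => // /(_ isT) ->.
Qed.

Lemma prefix_count_interleave (P : pred nat) K M :
  prefix_count P (K * M) =
  (\sum_(i < K) prefix_count (fun n => P (K * n + i)%N) M)%N.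
Proof.
elim: M => [|M IH].
  by rewrite muln0 {1}/prefix_count big_ord0 big1// => i _; rewrite /prefix_count big_ord0.
rewrite mulnS addnC prefix_countD IH -big_split /=.
by apply: eq_bigr => i _; rewrite prefix_countS.
Qed.

(** * Calculus of upper densities *)

Section UpperDensity.
Variable R : realType.
Implicit Types (P Q : pred nat) (l : R).

Lemma upper_density_le_sub P Q n0 l :
  (forall n, (n0 <= n)%N -> P n -> Q n) ->
  upper_density_le R Q l -> upper_density_le R P l.
Proof.
move=> PQ udQ e e0; have [C HC] := udQ e e0; exists (C + n0%:R) => N.
have := prefix_count_eventually_sub _ _ _ PQ N.
rewrite -(ler_nat R) natrD => /le_trans; apply.
by rewrite addrA lerD2r.
Qed.

Lemma upper_density_le_approx P l :
  (forall e : R, 0 < e -> upper_density_le R P (l + e)) -> upper_density_le R P l.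
Proof.
move=> H e e0; have e20 : 0 < e / 2 by rewrite divr_gt0.
have [C HC] := H _ e20 _ e20; exists C => N.
by rewrite [in l + e](splitr e) addrA.
Qed.

Lemma upper_density_le_shift P r0 l : 0 <= l ->
  upper_density_le R P l -> upper_density_le R (fun n => P (r0 + n)%N) l.
Proof.
move=> l0 udP e e0; have [C HC] := udP e e0; exists ((l + e) * r0%:R + C) => N.
have := HC (r0 + N)%N; rewrite prefix_countD !natrD mulrDr.
have : 0 <= (prefix_count P r0)%:R :> R by [].
lra.
Qed.

Lemma upper_density_le_interleave P K l : (0 < K)%N -> 0 <= l ->
  (forall i : 'I_K, upper_density_le R (fun n => P (K * n + i)%N) l) ->
  upper_density_le R P l.
Proof.
move=> K0 l0 H e e0.
have [C HC] := choice (fun i => H i e e0).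
exists ((l + e) * K%:R + \sum_i C i) => N.
(* [N] is rounded up to a whole number of periods; the excess is at most [K], paid for by the
   summand [(l + e) * K%:R] of the constant. *)
have le1 : (prefix_count P N)%:R <= (prefix_count P (K * (N %/ K).+1))%:R :> R.
  by rewrite ler_nat leq_prefix_count // mulnC ltnW // ltn_ceil.
apply: le_trans le1 _; rewrite prefix_count_interleave natr_sum.
apply: le_trans (ler_sum _ (fun i _ => HC i (N %/ K).+1)) _.
rewrite big_split /= addrA lerD2r sumr_const card_ord -[leLHS]mulr_natr -mulrA -mulrDr.
rewrite ler_wpM2l ?addr_ge0// ?(ltW e0)// -natrM -natrD ler_nat mulSn.
by have := leq_trunc_div N K; lia.
Qed.

(* Complements turn the two upper bounds into a limit. *)
Lemma density_cvg P l :
  upper_density_le R P l -> upper_density_le R (predC P) (1 - l) ->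
  (prefix_count P N)%:R / N%:R @[N --> \oo] --> l.
Proof.
move=> ud1 ud2; apply/cvgrPdist_le => e e0.
have e20 : 0 < e / 2 by rewrite divr_gt0.
have [C HC] := ud1 _ e20; have [C' HC'] := ud2 _ e20.
have CN : \forall N \near \oo, 2 * (`|C| + `|C'|) / e <= N%:R.
  exact: nbhs_infty_ger.
near=> N.
have N0 : 0 < N%:R :> R by rewrite ltr0n; near: N; exact: nbhs_infty_gt.
have hN : 2 * (`|C| + `|C'|) <= e * N%:R.
  by rewrite [e * _]mulrC -ler_pdivrMr //; near: N.
have h1 := HC N; have h2 := HC' N.
have h3 : (prefix_count P N)%:R + (prefix_count (predC P) N)%:R = N%:R :> R.
  by rewrite -natrD prefix_countC.
have c1 := ler_norm C; have c2 := ler_norm C'.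
have n1 := normr_ge0 C; have n2 := normr_ge0 C'.
have -> : l - (prefix_count P N)%:R / N%:R =
  (l * N%:R - (prefix_count P N)%:R) / N%:R by field; rewrite gt_eqF.
rewrite normrM normfV (gtr0_norm N0) ler_pdivrMr // ler_norml.
move: h1 h2 h3 hN; set c := (prefix_count P N)%:R; set c' := (prefix_count (predC P) N)%:R.
set n := N%:R.
rewrite !mulrDl mulNr mul1r !(mulrAC e 2^-1); set x := l * n; set y := e * n.
by move=> h1 h2 h3 hN; apply/andP; split; lra.
Unshelve. all: by end_near.
Qed.

End UpperDensity.

(** * Fractional parts and equidistribution of irrational rotations *)

Section IrrationalRotation.
Variable R : realType.
Implicit Types x y c l theta : R.

Definition fract x : R := x - (Num.floor x)%:~R.

Lemma fract_ge0 x : 0 <= fract x.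
Proof. by rewrite subr_ge0 floor_le. Qed.

Lemma fract_lt1 x : fract x < 1.
Proof. by have := floorD1_gt x; rewrite intrD /fract; lra. Qed.

Lemma fract_def x (p : int) : 0 <= x - p%:~R < 1 -> fract x = x - p%:~R.
Proof.
move=> /andP[h1 h2]; rewrite /fract (@floor_def _ _ p)// intrD.
by apply/andP; split; lra.
Qed.

Lemma fractDz x (p : int) : fract (x + p%:~R) = fract x.
Proof.
rewrite (@fract_def _ (Num.floor x + p)) intrD.
  by rewrite /fract; ring.
by have := fract_ge0 x; have := fract_lt1 x; rewrite /fract => ? ?; apply/andP; split; lra.
Qed.

Lemma fractD x y : 0 <= y < 1 ->
  fract (x + y) = if fract x + y < 1 then fract x + y else fract x + y - 1.
Proof.
move=> /andP[y0 y1]; have f0 := fract_ge0 x; have f1 := fract_lt1 x.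
have E : x = fract x + (Num.floor x)%:~R by rewrite /fract; ring.
rewrite {1}E addrAC fractDz; case: ltrP => h.
  by rewrite (@fract_def _ 0) subr0// h addr_ge0.
by rewrite (@fract_def _ 1)//; apply/andP; split; lra.
Qed.

Lemma fract_lt_sub x y l : 0 <= y -> 0 <= l -> l + y < 1 ->
  fract x < l -> fract (x + y) < l + y.
Proof.
move=> y0 l0 ly h; have f0 := fract_ge0 x.
rewrite fractD; last by apply/andP; split; lra.
by case: (ltrP (fract x + y) 1) => ?; lra.
Qed.

(** Rotating by [l] moves the complementary arc from [l] back to the origin, so complements again
    have the form handled by the upper bounds. *)
Lemma fract_geE x l : 0 <= l <= 1 -> (l <= fract x) = (fract (x - l) < 1 - l).
Proof.
move=> /andP[l0 l1]; have f0 := fract_ge0 x; have f1 := fract_lt1 x.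
have [->|ln1] := eqVneq l 1.
  by have := fract_ge0 (x - 1) => ?; apply/idP/idP => ?; lra.
have {}l1 : l < 1 by rewrite lt_neqAle ln1.
have := @fractD (x - l) l; rewrite subrK l0 l1 => /(_ isT).
have f0' := fract_ge0 (x - l); have f1' := fract_lt1 (x - l).
by case: (ltrP (fract (x - l) + l) 1) => h1 h2; apply/idP/idP => h3; lra.
Qed.

Definition irrational_step theta : Prop :=
  forall (q : nat) (p : int), (0 < q)%N -> q%:R * theta != p%:~R.

(** Pigeonhole: among [n + 1] multiples of [theta], two have fractional parts in the same box of
    width [1 / n]; their difference gives [q]. *)
Lemma dirichlet_approximation theta e : 0 < e -> exists (q : nat) (p : int),
  (0 < q)%N /\ `|q%:R * theta - p%:~R| < e.
Proof.
move=> e0; pose n := (Num.trunc e^-1).+1.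
have n0 : 0 < n%:R :> R by rewrite ltr0n.
have ne : n%:R^-1 < e.
  rewrite -[e]invrK ltf_pV2 ?posrE ?invr_gt0//.
  by apply: truncnS_gt.
(* [g i] is the index of the box containing the fractional part of [i * theta]. *)
pose g (i : 'I_n.+1) : nat := `|Num.floor (n%:R * fract (i%:R * theta))|%N.
have gE i : (g i)%:Z = Num.floor (n%:R * fract (i%:R * theta)).
  by rewrite /g gez0_abs // floor_ge0 mulr_ge0 ?fract_ge0.
have glt i : (g i < n)%N.
  rewrite -ltz_nat gE floor_lt_int -pmulrn -{2}[n%:R]mulr1.
  by rewrite ltr_pM2l ?fract_lt1.
pose f (i : 'I_n.+1) : 'I_n := Ordinal (glt i).
have /injectivePn[i [j ij fij]] : ~~ injectiveb f.
  apply/negP => /injectiveP /leq_card; rewrite !card_ord; lia.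
have {}fij : g i = g j by have := congr1 val fij.
wlog {ij} ij : i j fij / (i < j)%N.
  move=> W; have [/W|/W|/val_inj] := ltngtP i j; [exact|exact|].
  by move=> E; rewrite E eqxx in ij.
exists (j - i)%N, (Num.floor (j%:R * theta) - Num.floor (i%:R * theta)).
split; first by rewrite subn_gt0.
apply: le_lt_trans ne; rewrite natrB ?(ltnW ij)// intrB.
have -> : (j%:R - i%:R) * theta - ((Num.floor (j%:R * theta))%:~R -
   (Num.floor (i%:R * theta))%:~R) = fract (j%:R * theta) - fract (i%:R * theta).
  by rewrite /fract; ring.
rewrite -(ler_pM2l n0) divff ?gt_eqF// -{1}[n%:R]gtr0_norm// -normrM mulrBr.
have /andP[] := floor_itv (n%:R * fract (j%:R * theta)).
have /andP[] := floor_itv (n%:R * fract (i%:R * theta)).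
rewrite -!gE fij intrD => h1 h2 h3 h4.
by rewrite ler_norml; apply/andP; split; lra.
Qed.

(* The deviation of the occupation time of [0, L] by a uniform motion on the
   circle from its mean. *)
Let sawtooth (L f : R) : R := Num.min f L - L * f.

Let sawtooth_itv (L f : R) : 0 <= L <= 1 -> 0 <= f <= 1 -> 0 <= sawtooth L f <= 1.
Proof.
move=> /andP[L0 L1] /andP[f0 f1]; rewrite /sawtooth.
have := mulr_ge0 L0 f0; have : 0 <= (1 - L) * (1 - f) by rewrite mulr_ge0; lra.
have : 0 <= (1 - L) * f by rewrite mulr_ge0; lra.
have : 0 <= L * (1 - f) by rewrite mulr_ge0; lra.
rewrite !mulrBl !mulrBr !mulr1 !mul1r.
by case: (leP f L) => h ? ? ? ?; apply/andP; split; lra.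
Qed.

(** The sawtooth has slope [1 - L] up to [L], slope [- L] afterwards, and vanishes at both 0 and 1.
    With [L = l + d], a point starting below [l] stays on the rising piece for the whole move, hence
    gains exactly [d * (1 - L)]; any other point loses at most [d * L]. *)
Let sawtooth_step (d l y : R) : 0 < d -> 0 <= l -> l + d <= 1 -> d < 1 ->
  d * ((fract y < l)%R%:R - (l + d)) <=
  sawtooth (l + d) (fract (y + d)) - sawtooth (l + d) (fract y).
Proof.
move=> d0 l0 ld d1; rewrite fractD ?(ltW d0)//.
have := fract_ge0 y; have := fract_lt1 y.
move: (fract y) => f f1 f0; rewrite /sawtooth; set L := l + d.
have -> : d * ((f < l)%R%:R - L) = d * (f < l)%R%:R - L * d by ring.
case: (ltrP (f + d) 1) => h.
  rewrite [L * (f + d)]mulrDr; case: (ltrP f l) => fl; rewrite ?mulr1 ?mulr0.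
    by rewrite !min_l; rewrite /L; lra.
  suff : Num.min f L <= Num.min (f + d) L by lra.
  by rewrite le_min !ge_min lexx !orbT andbT; apply/orP; left; lra.
(* Wrapping around forces [f >= 1 - d >= l], so the indicator is 0. *)
rewrite ltNge (_ : l <= f) /=; last lra.
rewrite mulr0 [L * (f + d - 1)]mulrBr [L * (f + d)]mulrDr mulr1.
have : 0 <= Num.min (f + d - 1) L by rewrite le_min; apply/andP; split; rewrite /L; lra.
have : Num.min f L <= L by rewrite ge_min lexx orbT.
lra.
Qed.

(** After cancellation only the first [q] and the last [q] terms remain, and each of these blocks
    sums to a value between 0 and [q]. *)
Let sum_shift_sub (h : nat -> R) (q N : nat) : (forall n, 0 <= h n <= 1) ->
  `|\sum_(n < N) h (q + n)%N - \sum_(n < N) h n| <= q%:R.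
Proof.
move=> hh.
have E M M' : \sum_(n < M + M') h n = \sum_(n < M) h n + \sum_(n < M') h (M + n)%N.
  by rewrite big_split_ord.
have := E q N; rewrite addnC E => {}E.
have B (g : nat -> nat) : 0 <= \sum_(n < q) h (g n) <= q%:R.
  rewrite sumr_ge0 => [|i _] /=; last by case/andP: (hh (g i)).
  rewrite -[q in q%:R]card_ord -sumr_const ler_sum // => i _.
  by case/andP: (hh (g i)).
have /andP[b1 b2] := B id; have /andP[b3 b4] := B (addn N).
by rewrite ler_norml; apply/andP; split; lra.
Qed.

Lemma rotation_upper_density theta c l :
  irrational_step theta -> 0 <= l <= 1 ->
  upper_density_le R (fun n => fract (n%:R * theta + c) < l) l.
Proof.
move=> irr /andP[l0 l1] e e0.
have [->|ln1] := eqVneq l 1.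
  exists 0 => N; rewrite addr0; apply: (@le_trans _ _ N%:R).
    by rewrite ler_nat prefix_count_le.
  by rewrite ler_peMl //; lra.
(* The bound [e] keeps the loss in density small; the bound [1 - l] keeps [L = l + d] below 1. *)
have m0 : 0 < Num.min e (1 - l).
  by rewrite lt_min e0 subr_gt0 lt_neqAle ln1.
have [q [p [q0 qp]]] := dirichlet_approximation theta _ m0.
have := irr q p q0; rewrite -subr_eq0 -normr_gt0.
set t := q%:R * theta - p%:~R in qp *; pose d := `|t|; rewrite -/d in qp * => d0.
move: qp; rewrite lt_min => /andP[de dl].
(* The telescoped sum is at most [q], and the sawtooth inequality carries a factor [d]. *)
exists (q%:R / d) => N.
pose h c n := sawtooth (l + d) (fract (n%:R * theta + c)).
have hh c' n : 0 <= h c' n <= 1.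
  by apply: sawtooth_itv; apply/andP; split; rewrite ?fract_ge0 ?(ltW (fract_lt1 _))//; lra.
suff [S HS HSq] : exists2 S : R, \sum_(n < N)
    d * ((fract (n%:R * theta + c) < l)%R%:R - (l + d)) <= S & S <= q%:R.
  rewrite -mulr_sumr sumrB sumr_const card_ord in HS.
  have := le_trans HS HSq; rewrite mulrC -ler_pdivlMr // -natr_sum -/(prefix_count _ N).
  rewrite -[(l + d) *+ N]mulr_natr => H.
  have : (l + d) * N%:R <= (l + e) * N%:R by rewrite ler_wpM2r//; lra.
  lra.
have step (n : nat) := @sawtooth_step d l (n%:R * theta + c) d0 l0.
(* If [t] is nonnegative, advancing the index by [q] moves the point forward by [d]. *)
have [t0|t0] := leP 0 t.
  exists (\sum_(n < N) h c (q + n)%N - \sum_(n < N) h c n); last first.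
    exact: le_trans (ler_norm _) (sum_shift_sub _ _ _ (hh c)).
  rewrite -sumrB; apply: ler_sum => i _.
  apply: (le_trans (step i _ _)); [lra|lra|rewrite lerD2r /h].
  have -> : (q + i)%:R * theta + c = i%:R * theta + c + d + p%:~R.
    by rewrite /d ger0_norm// /t natrD; ring.
  by rewrite fractDz.
(* For negative [t] advancing by [q] moves backwards, so the phase is pulled back: the index [q + n]
   of the new orbit gives the original point, and the index [n] gives that point moved forward by
   [d], modulo 1. *)
pose c' := c - q%:R * theta.
exists (\sum_(n < N) h c' n - \sum_(n < N) h c' (q + n)%N); last first.
  by apply: le_trans (ler_norm _) _; rewrite distrC; exact: (sum_shift_sub _ _ _ (hh c')).
rewrite -sumrB; apply: ler_sum => i _.
apply: (le_trans (step i _ _)); [lra|lra|rewrite /h].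
have -> : (q + i)%:R * theta + c' = i%:R * theta + c by rewrite /c' natrD; ring.
have -> : i%:R * theta + c + d = i%:R * theta + c' + p%:~R.
  by rewrite /d ltr0_norm// /t /c'; ring.
by rewrite fractDz.
Qed.

Lemma perturbed_rotation_upper_density theta c l (u : nat -> R) :
  irrational_step theta -> 0 <= l <= 1 ->
  u n - n%:R * theta @[n --> \oo] --> c ->
  upper_density_le R (fun n => fract (u n) < l) l.
Proof.
move=> irr /andP[l0 l1] ucv; apply: upper_density_le_approx => e e0.
have [le1|le1] := leP 1 (l + e).
  move=> e' e'0; exists 0 => N; rewrite addr0; apply: (@le_trans _ _ N%:R).
    by rewrite ler_nat prefix_count_le.
  by rewrite ler_peMl //; lra.
have e20 : 0 < e / 2 by rewrite divr_gt0.
move/cvgrPdist_lt: ucv => /(_ _ e20)[n0 _ Hn0].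
(* The offset [e / 2] makes the error one-sided: the rotation point exceeds [u n] by an amount
   between 0 and [e], so an arc of length [l + e] catches it. *)
apply: (@upper_density_le_sub _ _
  (fun n => fract (n%:R * theta + (c + e / 2)) < l + e) n0).
  move=> n /Hn0 /=; rewrite ltr_norml => /andP[h1 h2] h3.
  have -> : n%:R * theta + (c + e / 2) = u n + (n%:R * theta + (c + e / 2) - u n) by ring.
  apply: (@lt_le_trans _ _ (l + (n%:R * theta + (c + e / 2) - u n))); last lra.
  by apply: fract_lt_sub => //; lra.
by apply: rotation_upper_density => //; apply/andP; split; lra.
Qed.

End IrrationalRotation.

(** * Leading digits as arcs of the circle *)

Section DigitBlocks.
Variable R : realType.
Implicit Types x y s : R.

Definition digit_block (d : nat -> nat) (p : nat) : nat :=
  \sum_(1 <= j < p.+1) 10 ^ (p - j) * d j.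

Lemma digit_blockS d p :
  digit_block d p.+1 = (10 * digit_block d p + d p.+1)%N.
Proof.
rewrite /digit_block big_nat_recr //= subnn expn0 mul1n big_distrr /=.
congr addn; apply: eq_big_nat => j /andP[_ jp].
by rewrite mulnA -expnS subSn.
Qed.

Lemma digit_block_itv (d : nat -> nat) p : (1 <= d 1 <= 9)%N ->
  (forall j, (2 <= j <= p.+1)%N -> (d j <= 9)%N) ->
  (10 ^ p <= digit_block d p.+1 < 10 ^ p.+1)%N.
Proof.
move=> d1; elim: p => [|p IH] hd.
  by rewrite digit_blockS /digit_block big_geq //; lia.
have /IH : forall j, (2 <= j <= p.+1)%N -> (d j <= 9)%N.
  by move=> j /andP[j2 jp]; apply: hd; lia.
have := hd p.+2 (ltnSn _).
rewrite [digit_block d p.+2]digit_blockS [(10 ^ p.+2)%N]expnS [(10 ^ p.+1)%N]expnS.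
by move: (10 ^ p)%N => q; lia.
Qed.

(** Dropping the last decimal digit; this drives the induction on the number of digits. *)
Lemma floor10M y : Num.floor y = (Num.floor (y * 10) %/ 10)%Z.
Proof.
have /andP[h1 h2] := floor_itv y.
suff : 10 * Num.floor y <= Num.floor (y * 10) < 10 * Num.floor y + 10 by lia.
rewrite floor_ge_int floor_lt_int !(intrD, intrM).
by move: h2; rewrite intrD => h2; apply/andP; split; lra.
Qed.

(** Induction on [p]: division by 10 splits off the last digit, and digits at most 9 make the
    splitting unique. For one digit, [1 <= s < 10] makes the reduction modulo 10 harmless. *)
Lemma leading_digitsE s (d : nat -> nat) p : 1 <= s < 10 -> (1 <= d 1 <= 9)%N ->
  (forall j, (2 <= j <= p.+1)%N -> (d j <= 9)%N) ->
  (forall j, (j < p.+1)%N -> (Num.floor (s * 10 ^+ j) %% 10)%Z = d j.+1) <->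
  Num.floor (s * 10 ^+ p) = digit_block d p.+1.
Proof.
move=> /andP[s1 s10] d1; elim: p => [|p IH] hd.
  have f1 : 1 <= Num.floor s < 10.
    by rewrite floor_ge_int floor_lt_int; apply/andP.
  rewrite digit_blockS {1}/digit_block big_geq // muln0 add0n expr0 mulr1.
  split => [/(_ 0%N isT)|E [|//] _]; rewrite expr0 mulr1; lia.
have {}IH := IH (fun j h => hd j ltac:(lia)).
have dp := hd p.+2 ltac:(lia).
have E : Num.floor (s * 10 ^+ p) = (Num.floor (s * 10 ^+ p.+1) %/ 10)%Z.
  by rewrite floor10M exprSr mulrA.
rewrite digit_blockS; split => [H|H].
  have := H p.+1 (ltnSn _).
  have /IH : forall j, (j < p.+1)%N -> (Num.floor (s * 10 ^+ j) %% 10)%Z = d j.+1.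
    by move=> j jp; apply: H; lia.
  rewrite E; lia.
move=> j; rewrite ltnS leq_eqVlt => /orP[/eqP->|]; first by lia.
by move: j; apply/IH; rewrite E H; lia.
Qed.

Lemma ln10_gt0 : 0 < ln (10 : R).
Proof. by rewrite ln_gt0 // ltr1n. Qed.

Lemma ltr_log10 x y : 0 < x -> 0 < y -> (log10 x < log10 y) = (x < y).
Proof. by move=> x0 y0; rewrite /log10 ltr_pM2r ?invr_gt0 ?ln10_gt0// ltr_ln. Qed.

Lemma ler_log10 x y : 0 < x -> 0 < y -> (log10 x <= log10 y) = (x <= y).
Proof. by move=> x0 y0; rewrite !leNgt ltr_log10. Qed.

Lemma log10M x y : 0 < x -> 0 < y -> log10 (x * y) = log10 x + log10 y.
Proof. by move=> x0 y0; rewrite /log10 lnM // mulrDl. Qed.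

Lemma log10Xn x n : 0 < x -> log10 (x ^+ n) = n%:R * log10 x.
Proof. by move=> x0; rewrite /log10 lnXn // mulr_natl mulrnAl. Qed.

Lemma log10_10 : log10 (10 : R) = 1.
Proof. by rewrite /log10 divff // gt_eqF ?ln10_gt0. Qed.

Lemma log10_pow n : log10 (10 ^+ n : R) = n%:R.
Proof. by rewrite log10Xn // log10_10 mulr1. Qed.

Lemma log10_exprz (n : int) : log10 (10 ^ n : R) = n%:~R.
Proof.
case: n => n; first by rewrite -exprnP log10_pow.
rewrite NegzE -exprnN /log10 lnV ?posrE ?exprn_gt0 // mulNr.
by rewrite -/(log10 (10 ^+ n.+1)) log10_pow mulrNz.
Qed.

(** With [M] the digit block and [s] the significand, the digits match exactly when
    [M <= s * 10 ^+ p < M + 1]. Taking logarithms puts the fractional part of [log10] of the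
    absolute value of [x] in an arc starting at [log10 M - p], of length [log10 (1 + 1 / M)]. *)
Lemma digits_fractE x (d : nat -> nat) p : x != 0 -> (1 <= d 1 <= 9)%N ->
  (forall j, (2 <= j <= p.+1)%N -> (d j <= 9)%N) ->
  [forall j : 'I_p.+1, sig_digit j.+1 x == (d j.+1)%:Z] =
  (fract R (log10 `|x| - (log10 (digit_block d p.+1)%:R - p%:R)) <
     log10 (1 + 1 / (digit_block d p.+1)%:R)).
Proof.
move=> x0 d1 hd; set t := log10 `|x|; set M := digit_block d p.+1.
have /andP[M1 M2] : (10 ^ p <= M < 10 ^ p.+1)%N by exact: digit_block_itv.
have M0 : (0 < M)%N by apply: leq_trans M1; rewrite expn_gt0.
have MR : 0 < M%:R :> R by rewrite ltr0n.
have ax0 : 0 < `|x| by rewrite normr_gt0.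
set e := Num.floor t; pose s := `|x| * 10 ^ (- e).
have s0 : 0 < s by rewrite mulr_gt0 // exprz_gt0.
have logs : log10 s = fract R t.
  by rewrite log10M ?exprz_gt0// log10_exprz mulrNz.
have f0 := @fract_ge0 R t; have f1 := @fract_lt1 R t.
have s1 : 1 <= s < 10.
  rewrite -(ler_log10 _ _ ltr01 s0) -ltr_log10 // logs log10_10 f1 andbT.
  by rewrite {1}/log10 ln1 mul0r.
have digE (j : nat) : sig_digit j.+1 x = (Num.floor (s * 10 ^+ j) %% 10)%Z.
  rewrite /sig_digit -/t -/e (_ : `|x| * _ = s * 10 ^+ j) //.
  rewrite /s -mulrA; congr (_ * _).
  rewrite exprnP -expfzDr ?pnatr_eq0//; congr (_ ^ _).
  by rewrite -addn1 PoszD; ring.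
have -> : [forall j : 'I_p.+1, sig_digit j.+1 x == (d j.+1)%:Z] =
          (Num.floor (s * 10 ^+ p) == M).
  apply/forallP/eqP => [H|H j].
    apply/(leading_digitsE _ _ _ s1 d1 hd) => j jp.
    by rewrite -digE; apply/eqP/(H (Ordinal jp)).
  by rewrite digE; apply/eqP; move/(leading_digitsE _ _ _ s1 d1 hd): H; apply.
have p0 : 0 < 10 ^+ p :> R by rewrite exprn_gt0.
rewrite floor_eq -pmulrn (_ : (M + 1)%:~R = M.+1%:R); last by rewrite -addn1.
have sp0 : 0 < s * 10 ^+ p by rewrite mulr_gt0.
rewrite -(ler_log10 _ _ MR sp0) -(ltr_log10 _ _ sp0 (ltr0Sn R M)) log10M// logs log10_pow.
have -> : log10 (1 + 1 / M%:R) = log10 M.+1%:R - log10 M%:R :> R.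
  have -> : 1 + 1 / M%:R = M.+1%:R / M%:R :> R.
    by rewrite -natr1; field; rewrite gt_eqF.
  by rewrite /log10 ln_div ?posrE ?ltr0n// mulrBl.
(* Since [M] has exactly [p + 1] digits, the arc lies inside the unit interval and does not wrap
   around. *)
have b1 : p%:R <= log10 M%:R :> R.
  by rewrite -[leLHS]log10_pow ler_log10 // -natrX ler_nat.
have b2 : log10 M.+1%:R <= p%:R + 1 :> R.
  by rewrite natr1 -[leRHS]log10_pow ler_log10 ?ltr0n ?exprn_gt0// -natrX ler_nat.
have b3 : log10 M%:R < log10 M.+1%:R :> R by rewrite ltr_log10 ?ltr0n// ltr_nat.
set a := log10 M%:R - p%:R.
have a1 : 0 <= a < 1 by rewrite /a; apply/andP; split; lra.
have := @fractD R (t - a) a a1; rewrite subrK.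
have g0 := @fract_ge0 R (t - a); have g1 := @fract_lt1 R (t - a).
rewrite /a in g0 g1 *.
case: (ltrP (fract R (t - (log10 M%:R - p%:R)) + (log10 M%:R - p%:R)) 1) => h1 h2.
  by apply/andP/idP => [[? ?]|?]; [|split]; lra.
by apply/andP/idP => [[? ?]|?]; [|split]; lra.
Qed.

Lemma strong_benfordP (s : nat -> R) : (forall n, s n != 0) ->
  (forall a l, 0 <= l <= 1 ->
     upper_density_le R (fun n => fract R (log10 `|s n| - a) < l) l) ->
  strong_benford s.
Proof.
move=> s0 ud; split=> [n|[//|p] d _ d1 hd]; first exact/eqP.
set l : R := log10 _; rewrite -/(digit_block d p.+1) in l *.
have /andP[M1 M2] := digit_block_itv d p d1 hd.
set M := digit_block d p.+1 in l M1 M2 *.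
have M0 : (1 <= M)%N by apply: leq_trans M1; rewrite expn_gt0.
have MR : 1 <= M%:R :> R by rewrite ler1n.
have iM : 0 < (1 / M%:R : R) <= 1.
  by rewrite mul1r invr_gt0 invf_le1 ?ltr0n// M0.
have l01 : 0 <= l <= 1.
  have log1 : log10 1 = 0 :> R by rewrite /log10 ln1 mul0r.
  by rewrite -[X in X <= l <= _]log1 -[X in _ <= l <= X]log10_10 !ler_log10; lra.
pose a : R := log10 M%:R - p%:R.
pose P : pred nat := fun n => fract R (log10 `|s n| - a) < l.
have -> : (fun N => (digits_count s p.+1 d N)%:R / N%:R) =
          (fun N => (prefix_count P N)%:R / N%:R :> R).
  apply/funext => N; congr (_%:R / _).
  rewrite /digits_count -sum1_card big_mkcond /=; apply: eq_bigr => i _.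
  by rewrite inE digits_fractE.
apply: density_cvg; first exact: ud.
(* The complement is the arc of length [1 - l] starting at [a + l]. *)
apply: (@upper_density_le_sub _ _ (fun n => fract R (log10 `|s n| - (a + l)) < 1 - l) 0).
  by move=> n _ /=; rewrite /P -leNgt fract_geE// (opprD a l) [_ + (- a - l)]addrA.
by apply: ud; lra.
Qed.

End DigitBlocks.

(** * Interleaved sequences of the form A b^n + B b^-n *)

Section InterleavedGeometric.
Variables (R : realType) (b : R).
Hypothesis b1 : 1 < b.

Let b0 : 0 < b. Proof. exact: lt_trans b1. Qed.

Let bn_neq0 n : b ^+ n != 0. Proof. by rewrite expf_neq0 // gt_eqF. Qed.

Let correction_cvg (c : R) : c * b ^- 2 ^+ n @[n --> \oo] --> (0 : R).
Proof.
apply: (@cvg_geometric R c (b ^- 2)).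
by rewrite ger0_norm ?invr_ge0 ?exprn_ge0 ?(ltW b0)// invf_lt1 ?exprn_gt0// exprn_egt1.
Qed.

(** Isolates the dominant term; what remains is 1 plus a geometric sequence of ratio [b ^- 2], whose
    logarithm tends to 0. *)
Let two_sided_factor (A B : R) n : A != 0 ->
  A * b ^+ n + B * b ^- n = A * b ^+ n * (1 + B / A * b ^- 2 ^+ n).
Proof.
move=> A0; rewrite exprVn -exprM mulnC exprM; have := bn_neq0 n.
by set c := b ^+ n => c0; field; rewrite A0 c0.
Qed.

Let correction_gt0 (c : R) : \forall n \near \oo, 0 < 1 + c * b ^- 2 ^+ n.
Proof.
have /cvgrPdist_lt/(_ 1 ltr01) := correction_cvg c; apply: filterS => n.
by rewrite sub0r normrN ltr_norml => /andP[? _]; lra.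
Qed.

Lemma two_sided_neq0 (A B : R) : A != 0 ->
  \forall n \near \oo, A * b ^+ n + B * b ^- n != 0.
Proof.
move=> A0; apply: filterS (correction_gt0 (B / A)) => n c0.
by rewrite two_sided_factor // !mulf_neq0 // gt_eqF.
Qed.

Lemma log10_two_sided_cvg (A B : R) : A != 0 ->
  log10 `|A * b ^+ n + B * b ^- n| - n%:R * log10 b @[n --> \oo] --> log10 `|A|.
Proof.
move=> A0; pose r n : R := B / A * b ^- 2 ^+ n.
have : log10 `|A| + log10 (1 + r n) @[n --> \oo] --> log10 `|A| + log10 1.
  apply: cvgD; first exact: cvg_cst.
  apply: cvgM; last exact: cvg_cst.
  apply: continuous_cvg; first exact: continuous_ln.
  rewrite -[X in _ --> X]addr0; apply: cvgD; first exact: cvg_cst.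
  exact: correction_cvg.
have -> : log10 1 = 0 :> R by rewrite /log10 ln1 mul0r.
rewrite addr0; apply: cvg_trans; apply: near_eq_cvg.
apply: filterS (correction_gt0 (B / A)) => n c0.
rewrite two_sided_factor // !normrM (gtr0_norm c0) normrX (gtr0_norm b0).
rewrite !log10M ?mulr_gt0 ?normr_gt0 ?exprn_gt0// log10Xn// /r.
by ring.
Qed.

(** A term can vanish for small [n] when [A] and [B] have opposite signs, but only finitely often.
    Hence the two conclusions: one for sequences without zeros, one for a tail. *)
Lemma interleaved_two_sided_benford K (s : nat -> R) :
  (0 < K)%N -> irrational_step R (log10 b) ->
  (forall i : 'I_K, exists A B : R, A != 0 /\
     forall n, s (K * n + i)%N = A * b ^+ n + B * b ^- n) ->
  ((forall r, s r <> 0) -> strong_benford s) /\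
  exists r0, strong_benford (fun r => s (r0 + r)%N).
Proof.
move=> K0 irr hs.
have ud a l : 0 <= l <= 1 ->
    upper_density_le R (fun n => fract R (log10 `|s n| - a) < l) l.
  move=> l01; apply: (@upper_density_le_interleave _ _ K) => //; first by case/andP: l01.
  move=> i; have [A [B [A0 E]]] := hs i.
  apply: (@perturbed_rotation_upper_density _ (log10 b) (log10 `|A| - a)) => //.
  under eq_fun do rewrite E addrAC.
  by apply: cvgB; [exact: log10_two_sided_cvg|exact: cvg_cst].
split=> [s0|]; first by apply: strong_benfordP => // n; apply/eqP.
have /choice[N HN] : forall i : 'I_K, exists N : nat, forall n,
    (N <= n)%N -> s (K * n + i)%N != 0.
  move=> i.
  have [A [B [A0 E]]] := hs i; have [N _ HN] := two_sided_neq0 A B A0.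
  by exists N => n /HN /=; rewrite E.
(* Being a multiple of [K], the offset preserves residue classes, and it takes every class past its
   own threshold. *)
exists (K * \max_i N i)%N; apply: strong_benfordP => [r|a l l01]; last first.
  by apply: (@upper_density_le_shift _ (fun n => fract R (log10 `|s n| - a) < l));
    [case/andP: l01|exact: ud].
rewrite [r](divn_eq r K) addnA [(r %/ K * K)%N]mulnC -mulnDr.
apply: (HN (Ordinal (ltn_pmod r K0))).
by apply: leq_trans (leq_addr _ _); apply: leq_bigmax.
Qed.

End InterleavedGeometric.

(** * Conjugation and coordinates in Z(sqrt D) *)

Section QuadraticRing.
Variables (R : realType) (D : nat).
Hypothesis D_nonsquare : ~ exists n : nat, D = (n ^ 2)%N.
Local Notation zs := (zsqrt R D).
Local Notation rD := (Num.sqrt D%:R : R).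

Let rD2 : rD * rD = D%:R. Proof. by rewrite -expr2 sqr_sqrtr. Qed.

Let rD_neq0 : rD != 0.
Proof.
apply/eqP => E; apply: D_nonsquare; exists 0%N; apply/eqP.
by rewrite -(eqr_nat R) -rD2 E mul0r.
Qed.

(** Irrationality of the square root: from [a ^ 2 = D * b ^ 2] with [b] nonzero, [b] divides [a],
    and [D] would be the square of the quotient. *)
Lemma zsqrt_eq0 (a b : int) : zs a b = 0 -> a = 0 /\ b = 0.
Proof.
rewrite /zsqrt => E.
have {}E : a * a = D%:Z * (b * b).
  apply/eqP; rewrite -(eqr_int R) !intrM -pmulrn -rD2; apply/eqP.
  have -> : a%:~R = - (b%:~R * rD) by move: E; lra.
  by ring.
have [b0|b0] := eqVneq b 0.
  by split=> //; apply/eqP; move/eqP: E; rewrite b0 !mulr0 mulf_eq0 orbb.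
case: D_nonsquare; exists (`|a| %/ `|b|)%N.
have EN : (`|a| ^ 2 = D * `|b| ^ 2)%N.
  by have := congr1 absz E; rewrite !abszM /= !mulnn.
have : (`|b| ^ 2 %| `|a| ^ 2)%N by rewrite EN dvdn_mull.
rewrite dvdn_pexp2r// => ba; apply/eqP.
by rewrite -(@eqn_pmul2r (`|b| ^ 2)) ?expn_gt0 ?absz_gt0 ?b0// -expnMn divnK// EN.
Qed.

(** Conjugation is a relation because elements are plain reals, with no coordinates attached. *)
Definition conj_pair (z z' : R) : Prop :=
  exists a b : int, z = zs a b /\ z' = zs a (- b).

Lemma conj_pairM z z' w w' :
  conj_pair z z' -> conj_pair w w' -> conj_pair (z * w) (z' * w').
Proof.
move=> [a [b [-> ->]]] [c [d [-> ->]]].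
exists (a * c + D%:Z * (b * d)), (a * d + b * c); rewrite /zsqrt.
rewrite !(intrD, intrM, mulrNz) -pmulrn; move: rD2; set r := rD => <-.
by split; ring.
Qed.

Lemma conj_pairN z z' : conj_pair z z' -> conj_pair (- z) (- z').
Proof.
move=> [a [b [-> ->]]]; exists (- a), (- b); rewrite /zsqrt !mulrNz.
by split; ring.
Qed.

Lemma conj_pairX z z' n : conj_pair z z' -> conj_pair (z ^+ n) (z' ^+ n).
Proof.
move=> zz'; elim: n => [|n IH]; last by rewrite !exprS; exact: conj_pairM.
by exists 1, 0; rewrite /zsqrt oppr0 mul0r addr0.
Qed.

Lemma conj_pair_sym z z' : conj_pair z z' -> conj_pair z' z.
Proof. by move=> [a [b [-> ->]]]; exists a, (- b); rewrite opprK. Qed.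

(** Uniqueness of coordinates identifies those of the pair with [x] and [y]; half the sum and the
    scaled difference then recover them. *)
Lemma conj_pair_coords z z' (x y : int) : conj_pair z z' -> z = zs x y ->
  x%:~R = (z + z') / 2 /\ y%:~R = (z - z') / (2 * rD).
Proof.
move=> [a [b [-> ->]]] E.
have /zsqrt_eq0[/eqP] : zs (a - x) (b - y) = 0.
  by move: E; rewrite /zsqrt !intrB !mulrBl; lra.
rewrite subr_eq0 => /eqP <- /eqP; rewrite subr_eq0 => /eqP <-.
rewrite /zsqrt mulrNz; split; first by field.
by field.
Qed.

Lemma zsqrt_conjM (a b : int) : zs a b * zs a (- b) = (int_norm D a b)%:~R.
Proof.
rewrite /zsqrt /int_norm !expr2 !(intrD, intrM, mulrNz) -pmulrn.
by move: rD2; set r := rD => <-; ring.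
Qed.

Lemma norm_class_conj (k : int) z : norm_class R D k z ->
  exists2 z', conj_pair z z' & z * z' = k%:~R.
Proof.
move=> [a [b [-> <-]]]; exists (zs a (- b)); last exact: zsqrt_conjM.
by exists a, b.
Qed.

Lemma unit_orbit_conj (k : int) z w : norm_class R D k z -> unit_orbit D z w ->
  exists2 w', conj_pair w w' & w * w' = k%:~R.
Proof.
move=> /norm_class_conj[z' zz' Ez] [g /norm_class_conj[g' gg' Eg] <-].
exists (g' * z'); first exact: conj_pairM.
by rewrite mulrACA Eg Ez mul1r.
Qed.

(** * The fundamental unit and the canonical orbit sequences *)

Section FundamentalUnit.
Variables x1 y1 : int.
Hypothesis fund : fundamental D x1 y1.
Local Notation beta := (zs x1 y1).

Lemma fundamental_gt1 : 1 < beta.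
Proof.
case: fund => x0 y0 _ _; rewrite /zsqrt.
have : 1 <= x1%:~R :> R by rewrite ler1z; lia.
have : 0 < y1%:~R * rD by rewrite mulr_gt0 ?ltr0z// lt_neqAle eq_sym rD_neq0 sqrtr_ge0.
lra.
Qed.

Lemma zsqrt_conj_inv : zs x1 (- y1) = beta^-1.
Proof.
have b0 : beta != 0 by rewrite gt_eqF// (lt_trans ltr01)// fundamental_gt1.
by apply: (mulfI b0); rewrite zsqrt_conjM; case: fund => _ _ -> _; rewrite divff.
Qed.

Lemma fundamental_conj : conj_pair beta beta^-1.
Proof. by exists x1, y1; rewrite zsqrt_conj_inv. Qed.

(* If beta^q = 10^p, the integer trace beta^q + beta^-q is 10^p + 10^-p. *)
Lemma log10_fundamental_irrational : irrational_step R (log10 beta).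
Proof.
move=> q p q0; apply/eqP => E.
have b1 := fundamental_gt1; have b0 : 0 < beta := lt_trans ltr01 b1.
have lb0 : 0 < log10 beta by rewrite /log10 divr_gt0 ?ln10_gt0// ln_gt0.
have : 0 < p%:~R :> R by rewrite -E mulr_gt0 ?ltr0n.
rewrite ltr0z; case: p E => [[|p]|p] E // _.
have {}E : beta ^+ q = 10 ^+ p.+1.
  apply: ln_inj; rewrite ?posrE ?exprn_gt0//.
  have h : ln (10 : R) != 0 by rewrite gt_eqF ?ln10_gt0.
  apply: (mulIf (invr_neq0 h)); rewrite -!/(log10 _) log10Xn// E log10_pow.
  by [].
have [a [c [Ea Ec]]] := conj_pairX _ _ q fundamental_conj.
have h10 : 10 ^+ p.+1 != 0 :> R by rewrite expf_neq0 // pnatr_eq0.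
have S : 2 * a%:~R = 10 ^+ p.+1 + 10 ^- p.+1 :> R.
  rewrite -E -exprVn Ec Ea /zsqrt mulrNz; ring.
have : (2 * a * 10 ^+ p.+1 = 10 ^+ p.+1 * 10 ^+ p.+1 + 1).
  apply/eqP; rewrite -(eqr_int R); apply/eqP.
  rewrite !(intrD, intrM, rmorphXn) /= S mulrDl mulVf//.
(* Modulo 10 the left side is 0 and the right side is 1. *)
rewrite exprS; move: (10 ^+ p) => t; lia.
Qed.

(** The conjugate of [alpha * beta ^+ n] is [alpha' * beta ^- n], so sums and differences are
    two-sided. The leading coefficients are nonzero because [alpha * alpha' = k] is. *)
Lemma canonical_orbit_coords (alpha : R) (k : int) (c : 'I_4) :
  k <> 0 -> (exists2 alpha', conj_pair alpha alpha' & alpha * alpha' = k%:~R) ->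
  exists A B A' B' : R, [/\ A != 0, A' != 0 & forall n (x y : int),
    canonical_orbit_seq D x1 y1 alpha c n = zs x y ->
    x%:~R = A * beta ^+ n + B * beta ^- n /\
    y%:~R = A' * beta ^+ n + B' * beta ^- n].
Proof.
move=> k0 [alpha' aa' Ek].
have b0 : beta != 0 by rewrite gt_eqF// (lt_trans ltr01)// fundamental_gt1.
have : alpha * alpha' != 0 by rewrite Ek intr_eq0; apply/eqP.
rewrite mulf_eq0 negb_or => /andP[a0 a0'].
have cX n := conj_pairX _ _ n.+1 fundamental_conj.
have key (w w' g : R) : w != 0 -> w' != 0 -> conj_pair w w' ->
    g = beta \/ g = beta^-1 ->
  exists A B A' B' : R, [/\ A != 0, A' != 0 & forall n (x y : int),
    w * g ^+ n.+1 = zs x y ->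
    x%:~R = A * beta ^+ n + B * beta ^- n /\
    y%:~R = A' * beta ^+ n + B' * beta ^- n].
  move=> w0 w0' ww' [->|->].
    (* The extra factors [beta] and [beta^-1] come from the exponent [n.+1]. *)
    exists (w * beta / 2), (w' / beta / 2), (w * beta / (2 * rD)), (- w' / beta / (2 * rD)).
    split; rewrite ?mulf_neq0 ?invr_neq0 ?mulf_neq0 ?pnatr_eq0// => n x y E.
    have [-> ->] := conj_pair_coords _ _ _ _ (conj_pairM _ _ _ _ ww' (cX n)) E.
    rewrite exprVn exprS; have := expf_neq0 n b0; move: (beta ^+ n) => t t0.
    by split; field; rewrite ?b0 ?t0 ?rD_neq0.
  (* For [beta^-1] the growing power sits on the conjugate, so [w] and [w'] trade places and the
     difference changes sign. *)
  exists (w' * beta / 2), (w / beta / 2), (- w' * beta / (2 * rD)), (w / beta / (2 * rD)).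
  split; rewrite ?mulf_neq0 ?invr_neq0 ?mulf_neq0 ?oppr_eq0 ?pnatr_eq0// => n x y E.
  have [-> ->] := conj_pair_coords _ _ _ _
    (conj_pairM _ _ _ _ ww' (conj_pair_sym _ _ (cX n))) E.
  rewrite exprVn exprS; have := expf_neq0 n b0; move: (beta ^+ n) => t t0.
  by split; field; rewrite ?b0 ?t0 ?rD_neq0.
have na0 : - alpha != 0 by rewrite oppr_eq0.
have na0' : - alpha' != 0 by rewrite oppr_eq0.
have naa' := conj_pairN _ _ aa'.
rewrite /canonical_orbit_seq zsqrt_conj_inv.
case: c => -[|[|[|[|//]]]] /= _.
- by apply: (key alpha alpha' beta) => //; left.
- by apply: (key alpha alpha' beta^-1) => //; right.
- by apply: (key (- alpha) (- alpha') beta) => //; left.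
- by apply: (key (- alpha) (- alpha') beta^-1) => //; right.
Qed.

End FundamentalUnit.
End QuadraticRing.

(** * Benford behaviour of both coordinates *)

(** A coordinate can vanish: if some [alpha i] is the fundamental unit, its product with the
    conjugate is 1, whose second coordinate is 0. The Benford property excludes zero terms, so it is
    asserted for each coordinate sequence when it has no zeros, and for a tail in every case. *)
Theorem theorem5p2 (R : realType) (D : nat) (k : int) (x1 y1 : int)
    (m : nat) (O : 'I_m -> set R) (alpha : 'I_m -> R)
    (listing : 'I_(4 * m) -> 'I_m * 'I_4) (z : nat -> R) (X Y : nat -> int)
    (hD0 : (0 < D)%N)
    (hD : ~ exists n : nat, D = (n ^ 2)%N)
    (hk : k <> 0)
    (hne : norm_class R D k !=set0)
    (hfund : fundamental D x1 y1)
    (hO : set_bij [set: 'I_m] (orbits R D k) O)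
    (halpha : forall i, O i (alpha i))
    (hlisting : bijective listing)
    (hz : is_interleavement
            (fun j : 'I_(4 * m) => canonical_orbit_seq D x1 y1
               (alpha (listing j).1) (listing j).2) z)
    (hXY : forall r, z r = zsqrt R D (X r) (Y r)) :
  (((forall r, X r <> 0) -> strong_benford (fun r => (X r)%:~R : R)) /\
   (exists r0, strong_benford (fun r => (X (r0 + r)%N)%:~R : R))) /\
  (((forall r, Y r <> 0) -> strong_benford (fun r => (Y r)%:~R : R)) /\
   (exists r0, strong_benford (fun r => (Y (r0 + r)%N)%:~R : R))).
Proof.
have b1 := @fundamental_gt1 R D hD x1 y1 hfund.
have irr := @log10_fundamental_irrational R D hD x1 y1 hfund.
have [hOsub _ hOsurj] := hO.
(* A nonempty norm class contains an orbit, so there is at least one index. *)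
have m0 : (0 < 4 * m)%N.
  case: hne => a0 ha0.
  have [i _ _] : (O @` setT) (unit_orbit D a0) by apply: hOsurj; exists a0.
  by rewrite muln_gt0 /=; apply: leq_ltn_trans (ltn_ord i).
have coords (j : 'I_(4 * m)) := @canonical_orbit_coords R D hD x1 y1 hfund
  (alpha (listing j).1) k (listing j).2 hk.
have hconj i : exists2 a', conj_pair R D (alpha i) a' & alpha i * a' = k%:~R.
  have [a0 ha0 Ea0] := hOsub i I.
  by apply: (unit_orbit_conj R D _ _ _ ha0); rewrite Ea0; exact: halpha.
have intr0 (s : nat -> int) : (forall r, s r <> 0) -> forall r, (s r)%:~R <> 0 :> R.
  by move=> s0 r /eqP; rewrite intr_eq0 => /eqP; exact: s0.
have E (j : 'I_(4 * m)) n : canonical_orbit_seq D x1 y1 (alpha (listing j).1) (listing j).2 n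
    = zsqrt R D (X (4 * m * n + j)%N) (Y (4 * m * n + j)%N) by rewrite -hXY hz.
have hX (j : 'I_(4 * m)) : exists A B : R, A != 0 /\ forall n,
    (X (4 * m * n + j)%N)%:~R = A * zsqrt R D x1 y1 ^+ n + B * zsqrt R D x1 y1 ^- n.
  have [A [B [A' [B' [A0 _ AB]]]]] := coords j (hconj _).
  by exists A, B; split=> // n; have [] := AB n _ _ (E j n).
have hY (j : 'I_(4 * m)) : exists A B : R, A != 0 /\ forall n,
    (Y (4 * m * n + j)%N)%:~R = A * zsqrt R D x1 y1 ^+ n + B * zsqrt R D x1 y1 ^- n.
  have [A [B [A' [B' [_ A0' AB]]]]] := coords j (hconj _).
  by exists A', B'; split=> // n; have [] := AB n _ _ (E j n).
have [X1 X2] := interleaved_two_sided_benford R _ b1 _ (fun r => (X r)%:~R) m0 irr hX.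
have [Y1 Y2] := interleaved_two_sided_benford R _ b1 _ (fun r => (Y r)%:~R) m0 irr hY.
by split; split=> // /intr0.
Qed.
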